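(* For every stoup $S$, context $\Gamma$ and formula $C$, the translation $\mathrm{sound}$ induces a bijection between $\circeq$-equivalence classes of cut-free derivations of $S \mid \Gamma \vdash C$ and $\doteq$-equivalence classes of categorical-calculus derivations $\llbracket S \mid \Gamma \rrbracket \Rightarrow C$ (i.e., $\mathrm{sound}$ respects $\circeq$, every derivation $\llbracket S \mid \Gamma\rrbracket \Rightarrow C$ is $\doteq$ to $\mathrm{sound}\, f$ for some cut-free $f$, and $\mathrm{sound}\, f \doteq \mathrm{sound}\, g$ implies $f \circeq g$). In particular, $\circeq$-classes of cut-free derivations of $A \mid\ \vdash C$ are in bijection with $\doteq$-classes of derivations $A \Rightarrow C$, i.e. with morphisms $A \to C$ of the free skew monoidal category on $\mathrm{Var}$.
   Context: Fix a set $\mathrm{Var}$ of atoms. Formulae: atoms $X \in \mathrm{Var}$, $\mathsf{I}$, and $A \otimes B$ for formulae $A, B$. A context is a finite list of formulae; a stoup $S$ is either empty (written $-$) or a single formula. Categorical calculus: judgements $A \Rightarrow C$ derived by $\mathrm{id}_A : A \Rightarrow A$; $g \circ f : A \Rightarrow C$ from $f : A \Rightarrow B$, $g : B \Rightarrow C$; $f \otimes g : A \otimes B \Rightarrow C \otimes D$ from $f : A \Rightarrow C$, $g : B \Rightarrow D$; axioms $\lambda_A : \mathsf{I} \otimes A \Rightarrow A$, $\rho_A : A \Rightarrow A \otimes \mathsf{I}$, $\alpha_{A,B,C} : (A \otimes B) \otimes C \Rightarrow A \otimes (B \otimes C)$. The relation $\doteq$ is the least congruence (w.r.t. $\circ$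 and $\otimes$) containing: $f \circ \mathrm{id} \doteq f \doteq \mathrm{id} \circ f$; $h \circ (g \circ f) \doteq (h \circ g) \circ f$; $\mathrm{id}_A \otimes \mathrm{id}_B \doteq \mathrm{id}_{A \otimes B}$; $(h \circ f) \otimes (k \circ g) \doteq (h \otimes k) \circ (f \otimes g)$; $\lambda_B \circ (\mathrm{id}_{\mathsf I} \otimes f) \doteq f \circ \lambda_A$; $(f \otimes \mathrm{id}_{\mathsf I}) \circ \rho_A \doteq \rho_B \circ f$; $(f \otimes (g \otimes h)) \circ \alpha \doteq \alpha \circ ((f \otimes g) \otimes h)$; $\lambda_{\mathsf I} \circ \rho_{\mathsf I} \doteq \mathrm{id}_{\mathsf I}$; $(\mathrm{id}_A \otimes \lambda_B) \circ \alpha_{A,\mathsf I,B} \circ (\rho_A \otimes \mathrm{id}_B) \doteq \mathrm{id}_{A \otimes B}$; $\lambda_{A \otimes B} \circ \alpha_{\mathsf I,A,B} \doteq \lambda_A \otimes \mathrm{id}_B$; $\alpha_{A,B,\mathsf I} \circ \rho_{A \otimes B} \doteq \mathrm{id}_A \otimes \rho_B$; $\alpha_{A,B,C \otimes D} \circ \alpha_{A \otimes B,C,D} \doteq (\mathrm{id}_A \otimes \alpha_{B,C,D}) \circ \alpha_{A,B \otimes C,D} \circ (\alpha_{A,B,C} \otimes \mathrm{id}_D)$. The $\doteq$-classes are the morphisms of the free skew monoidal category on $\mathrm{Var}$. Cut-free sequent calculus: sequents $S \mid \Gamma \vdash C$ derived by (ax) $A \mid\ \vdash A$; (pass) from $A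 \mid \Gamma \vdash C$ infer $- \mid A, \Gamma \vdash C$; ($\mathsf I$L) from $- \mid \Gamma \vdash C$ infer $\mathsf I \mid \Gamma \vdash C$; ($\mathsf I$R) $- \mid\ \vdash \mathsf I$; ($\otimes$L) from $A \mid B, \Gamma \vdash C$ infer $A \otimes B \mid \Gamma \vdash C$; ($\otimes$R) from $S \mid \Gamma \vdash A$ and $- \mid \Delta \vdash B$ infer $S \mid \Gamma, \Delta \vdash A \otimes B$. The relation $\circeq$ is the least congruence on cut-free derivations containing: $\mathrm{ax}_{\mathsf I} \circeq \mathsf{I}\mathrm{L}(\mathsf I\mathrm R)$; $\mathrm{ax}_{A \otimes B} \circeq \otimes\mathrm L(\otimes\mathrm R(\mathrm{ax}_A, \mathrm{pass}(\mathrm{ax}_B)))$; $\otimes\mathrm R(\mathrm{pass}\, f, g) \circeq \mathrm{pass}(\otimes\mathrm R(f, g))$; $\otimes\mathrm R(\mathsf I\mathrm L\, f, g) \circeq \mathsf I\mathrm L(\otimes\mathrm R(f, g))$; $\otimes\mathrm R(\otimes\mathrm L\, f, g) \circeq \otimes\mathrm L(\otimes\mathrm R(f, g))$. Interpretation: $\llbracket - \rrbracket = \mathsf I$, $\llbracket A \rrbracket = A$; $\llbracket S \mid A_1,\dots,A_n \rrbracket = (\cdots(\llbracket S \rrbracket \otimes A_1)\cdots) \otimes A_n$. For $f : A \Rightarrow B$: $\llbracket f \mid () \rrbracket = f$, $\llbracket f \mid C, \Gamma \rrbracket = \llbracket f \otimes \mathrm{id}_C \mid \Gamma \rrbracket$.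 Define $\psi_{A,B,()} = \mathrm{id}_{A \otimes B}$, $\psi_{A,B,(C,\Gamma)} = \psi_{A,B \otimes C,\Gamma} \circ \llbracket \alpha_{A,B,C} \mid \Gamma \rrbracket$; $\varphi'_{A,(),\Delta} = \psi_{A,\mathsf I,\Delta} \circ \llbracket \rho_A \mid \Delta \rrbracket$, $\varphi'_{A,(C,\Gamma),\Delta} = \varphi'_{A \otimes C,\Gamma,\Delta}$, $\varphi_{S,\Gamma,\Delta} = \varphi'_{\llbracket S \rrbracket,\Gamma,\Delta} : \llbracket S \mid \Gamma,\Delta \rrbracket \Rightarrow \llbracket S \mid \Gamma \rrbracket \otimes \llbracket - \mid \Delta \rrbracket$. The translation $\mathrm{sound}$ from cut-free derivations of $S \mid \Gamma \vdash C$ to derivations $\llbracket S \mid \Gamma \rrbracket \Rightarrow C$: $\mathrm{sound}(\mathrm{ax}_C) = \mathrm{id}_C$; $\mathrm{sound}(\mathrm{pass}\, f) = \mathrm{sound}\, f \circ \llbracket \lambda_A \mid \Gamma' \rrbracket$ for $f : A \mid \Gamma' \vdash C$; $\mathrm{sound}(\mathsf I\mathrm L\, f) = \mathrm{sound}\, f$; $\mathrm{sound}(\otimes\mathrm L\, f) = \mathrm{sound}\, f$; $\mathrm{sound}(\mathsf I\mathrm R) = \mathrm{id}_{\mathsf I}$; $\mathrm{sound}(\otimes\mathrm R(f_1, f_2)) = (\mathrm{sound}\, f_1 \otimes \mathrm{sound}\, f_2) \circ \varphi_{S,\Gamma_1,\Gamma_2}$ for $f_1 : S \mid \Gamma_1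 \vdash C_1$, $f_2 : - \mid \Gamma_2 \vdash C_2$. *)

(* Defs.v *)
From Stdlib Require Import List FinFun.
Import ListNotations.

Set Implicit Arguments.
Unset Strict Implicit.
Unset Printing Implicit Defensive.

(* The constructor I is the unit formula; it shadows [Logic.I]. *)
Inductive fma (Var : Type) : Type :=
| Atom (X : Var)
| I
| Tensor (A B : fma Var).

Arguments I {Var}.

Declare Scope skew_scope.
Delimit Scope skew_scope with skew.
Open Scope skew_scope.

Notation "A ⊗ B" := (Tensor A B) (at level 40, left associativity) : skew_scope.

Definition ctx (Var : Type) : Type := list (fma Var).
Definition stoup (Var : Type) : Type := option (fma Var).

Reserved Notation "A ⇒ B" (at level 70, no associativity).
Reserved Notation "f ≐ g" (at level 70, no associativity).

Inductive cat (Var : Type) : fma Var -> fma Var -> Type :=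
| idc A : A ⇒ A
| comp A B C (g : B ⇒ C) (f : A ⇒ B) : A ⇒ C
| tens A B C D (f : A ⇒ C) (g : B ⇒ D) : A ⊗ B ⇒ C ⊗ D
| lam A : I ⊗ A ⇒ A
| rho A : A ⇒ A ⊗ I
| alpha A B C : (A ⊗ B) ⊗ C ⇒ A ⊗ (B ⊗ C)
where "A ⇒ B" := (cat A B) : skew_scope.

Arguments idc {Var} A.
Arguments lam {Var} A.
Arguments rho {Var} A.
Arguments alpha {Var} A B C.

Notation "g ∘ f" := (comp g f) (at level 50, left associativity) : skew_scope.
Notation "f ⊗c g" := (tens f g) (at level 40, left associativity) : skew_scope.

Inductive doteq (Var : Type) : forall A B : fma Var, A ⇒ B -> A ⇒ B -> Prop :=
| deq_refl A B (f : A ⇒ B) : f ≐ f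
| deq_sym A B (f g : A ⇒ B) : f ≐ g -> g ≐ f
| deq_trans A B (f g h : A ⇒ B) : f ≐ g -> g ≐ h -> f ≐ h
| deq_comp A B C (g g' : B ⇒ C) (f f' : A ⇒ B) :
    g ≐ g' -> f ≐ f' -> g ∘ f ≐ g' ∘ f'
| deq_tens A B C D (f f' : A ⇒ C) (g g' : B ⇒ D) :
    f ≐ f' -> g ≐ g' -> f ⊗c g ≐ f' ⊗c g'
| deq_idr A B (f : A ⇒ B) : f ∘ idc A ≐ f
| deq_idl A B (f : A ⇒ B) : f ≐ idc B ∘ f
| deq_assoc A B C D (f : A ⇒ B) (g : B ⇒ C) (h : C ⇒ D) :
    h ∘ (g ∘ f) ≐ (h ∘ g) ∘ f
| deq_tens_id A B : idc A ⊗c idc B ≐ idc (A ⊗ B)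
| deq_tens_comp A B C A' B' C'
    (f : A ⇒ B) (h : B ⇒ C) (g : A' ⇒ B') (k : B' ⇒ C') :
    (h ∘ f) ⊗c (k ∘ g) ≐ (h ⊗c k) ∘ (f ⊗c g)
| deq_lam A B (f : A ⇒ B) : lam B ∘ (idc I ⊗c f) ≐ f ∘ lam A
| deq_rho A B (f : A ⇒ B) : (f ⊗c idc I) ∘ rho A ≐ rho B ∘ f
| deq_alpha A B C A' B' C' (f : A ⇒ A') (g : B ⇒ B') (h : C ⇒ C') :
    (f ⊗c (g ⊗c h)) ∘ alpha A B C ≐ alpha A' B' C' ∘ ((f ⊗c g) ⊗c h)
| deq_lam_rho : lam I ∘ rho I ≐ idc I
| deq_lam_alpha_rho A B :
    (idc A ⊗c lam B) ∘ alpha A I B ∘ (rho A ⊗c idc B) ≐ idc (A ⊗ B)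
| deq_lam_alpha A B : lam (A ⊗ B) ∘ alpha I A B ≐ lam A ⊗c idc B
| deq_alpha_rho A B : alpha A B I ∘ rho (A ⊗ B) ≐ idc A ⊗c rho B
| deq_pentagon A B C D :
    alpha A B (C ⊗ D) ∘ alpha (A ⊗ B) C D
    ≐ (idc A ⊗c alpha B C D) ∘ alpha A (B ⊗ C) D ∘ (alpha A B C ⊗c idc D)
where "f ≐ g" := (doteq f g) : skew_scope.

Reserved Notation "S ∣ Γ ⊢ C" (at level 65, Γ at level 64, C at level 64).
Reserved Notation "f ≗ g" (at level 70, no associativity).

Inductive cf (Var : Type) : stoup Var -> ctx Var -> fma Var -> Type :=
| ax A : Some A ∣ [] ⊢ A
| pass A Γ C (f : Some A ∣ Γ ⊢ C) : None ∣ A :: Γ ⊢ C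
| IL Γ C (f : None ∣ Γ ⊢ C) : Some I ∣ Γ ⊢ C
| IR : None ∣ [] ⊢ I
| TL A B Γ C (f : Some A ∣ B :: Γ ⊢ C) : Some (A ⊗ B) ∣ Γ ⊢ C
| TR S Γ Δ A B (f : S ∣ Γ ⊢ A) (g : None ∣ Δ ⊢ B) : S ∣ Γ ++ Δ ⊢ A ⊗ B
where "S ∣ Γ ⊢ C" := (cf S Γ C) : skew_scope.

Arguments ax {Var} A.
Arguments IR {Var}.

Inductive circeq (Var : Type) :
  forall (S : stoup Var) (Γ : ctx Var) (C : fma Var),
    S ∣ Γ ⊢ C -> S ∣ Γ ⊢ C -> Prop :=
| ceq_refl S Γ C (f : S ∣ Γ ⊢ C) : f ≗ f
| ceq_sym S Γ C (f g : S ∣ Γ ⊢ C) : f ≗ g -> g ≗ f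
| ceq_trans S Γ C (f g h : S ∣ Γ ⊢ C) : f ≗ g -> g ≗ h -> f ≗ h
| ceq_pass A Γ C (f g : Some A ∣ Γ ⊢ C) : f ≗ g -> pass f ≗ pass g
| ceq_IL Γ C (f g : None ∣ Γ ⊢ C) : f ≗ g -> IL f ≗ IL g
| ceq_TL A B Γ C (f g : Some A ∣ B :: Γ ⊢ C) : f ≗ g -> TL f ≗ TL g
| ceq_TR S Γ Δ A B (f f' : S ∣ Γ ⊢ A) (g g' : None ∣ Δ ⊢ B) :
    f ≗ f' -> g ≗ g' -> TR f g ≗ TR f' g'
| ceq_ax_I : ax I ≗ IL IR
| ceq_ax_T A B : ax (A ⊗ B) ≗ TL (TR (ax A) (pass (ax B)))
(* both sides have the same type since (A :: Γ) ++ Δ is convertible to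
   A :: (Γ ++ Δ) *)
| ceq_TR_pass A Γ Δ B C (f : Some A ∣ Γ ⊢ B) (g : None ∣ Δ ⊢ C) :
    TR (pass f) g ≗ pass (TR f g)
| ceq_TR_IL Γ Δ B C (f : None ∣ Γ ⊢ B) (g : None ∣ Δ ⊢ C) :
    TR (IL f) g ≗ IL (TR f g)
| ceq_TR_TL A A' Γ Δ B C (f : Some A ∣ A' :: Γ ⊢ B) (g : None ∣ Δ ⊢ C) :
    TR (TL f) g ≗ TL (TR f g)
where "f ≗ g" := (circeq f g) : skew_scope.

Definition istoup (Var : Type) (S : stoup Var) : fma Var :=
  match S with Some A => A | None => I end.

(* ⟦ A ∣ Γ ⟧ *)
Fixpoint ictx (Var : Type) (A : fma Var) (Γ : ctx Var) : fma Var :=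
  match Γ with
  | [] => A
  | C :: Γ' => ictx (A ⊗ C) Γ'
  end.

(* ⟦ S ∣ Γ ⟧ *)
Definition iante (Var : Type) (S : stoup Var) (Γ : ctx Var) : fma Var :=
  ictx (istoup S) Γ.

(* ⟦ f ∣ Γ ⟧ *)
Fixpoint imap (Var : Type) (A B : fma Var) (f : A ⇒ B) (Γ : ctx Var) :
    ictx A Γ ⇒ ictx B Γ :=
  match Γ with
  | [] => f
  | C :: Γ' => imap (f ⊗c idc C) Γ'
  end.

Fixpoint psi (Var : Type) (A B : fma Var) (Γ : ctx Var) :
    ictx (A ⊗ B) Γ ⇒ A ⊗ ictx B Γ :=
  match Γ with
  | [] => idc (A ⊗ B)
  | C :: Γ' => psi A (B ⊗ C) Γ' ∘ imap (alpha A B C) Γ'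
  end.

Fixpoint phi' (Var : Type) (A : fma Var) (Γ Δ : ctx Var) :
    ictx A (Γ ++ Δ) ⇒ ictx A Γ ⊗ iante None Δ :=
  match Γ with
  | [] => psi A I Δ ∘ imap (rho A) Δ
  | C :: Γ' => phi' (A ⊗ C) Γ' Δ
  end.

Definition phi (Var : Type) (S : stoup Var) (Γ Δ : ctx Var) :
    iante S (Γ ++ Δ) ⇒ iante S Γ ⊗ iante None Δ :=
  phi' (istoup S) Γ Δ.

Fixpoint sound (Var : Type) (S : stoup Var) (Γ : ctx Var) (C : fma Var)
    (f : S ∣ Γ ⊢ C) : iante S Γ ⇒ C :=
  match f in S ∣ Γ ⊢ C return iante S Γ ⇒ C with
  | ax A => idc A
  | @pass _ A Γ' _ f => sound f ∘ imap (lam A) Γ'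
  | IL f => sound f
  | IR => idc I
  | TL f => sound f
  | @TR _ T Γ1 Γ2 _ _ f1 f2 => (sound f1 ⊗c sound f2) ∘ phi T Γ1 Γ2
  end.

Definition eq_class (X : Type) (R : X -> X -> Prop) : Type :=
  {P : X -> Prop | exists x, P = R x}.

Definition class_of (X : Type) (R : X -> X -> Prop) (x : X) : eq_class R :=
  exist _ (R x) (ex_intro _ x eq_refl).

Definition cf_class (Var : Type) (S : stoup Var) (Γ : ctx Var) (C : fma Var) :=
  eq_class (@circeq Var S Γ C).

(* morphisms A -> C of the free skew monoidal category on Var *)
Definition fsk_hom (Var : Type) (A C : fma Var) := eq_class (@doteq Var A C).

Definition cf_class_of (Var : Type) (S : stoup Var) (Γ : ctx Var) (C : fma Var)
    (f : S ∣ Γ ⊢ C) : cf_class S Γ C :=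
  class_of (@circeq Var S Γ C) f.

Definition fsk_class_of (Var : Type) (A C : fma Var) (h : A ⇒ C) : fsk_hom A C :=
  class_of (@doteq Var A C) h.

(* Main.v *)
(* For a formula C, the derivations of S ∣ Γ ⊢ C, as S and Γ vary, form a module over
   the left rules (pass, IL, TL).  Modulo ≗ this module is free: on ax if C is an atom,
   on IR if C = I, and on the derivations TR x y if C = A ⊗ B.  So a map out of it that commutes with the left
   rules is determined by its values on right rules, and may be prescribed there.
   Hence categorical derivations h : A ⇒ B act on sequent derivations ending in A,
   by maps of modules, without going through cut; each equation generating ≐ has only
   to be checked on right rules.  The map [sound] is itself a map of modules, which
   gives sound (act h x) ≐ h ∘ sound x.  Acting on the canonical derivation
   univ S Γ of S ∣ Γ ⊢ ⟦S ∣ Γ⟧ is then inverse to [sound]: sound (univ S Γ) is the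
   identity, and act (sound f) (univ S Γ) ≗ f by induction on f. *)
Require Import Defs.
From Stdlib Require Import List FinFun.
From Stdlib Require Import Setoid Morphisms.
From Stdlib Require Import FunctionalExtensionality PropExtensionality ProofIrrelevance.
Import ListNotations.

Set Implicit Arguments.
Unset Strict Implicit.
Unset Printing Implicit Defensive.

(** * Rewriting modulo [≐] and [≗] *)

#[export] Instance doteq_equivalence Var (A B : fma Var) :
  Equivalence (@doteq Var A B).
Proof.
split.
- exact (@deq_refl Var A B).
- exact (@deq_sym Var A B).
- exact (@deq_trans Var A B).
Qed.

#[export] Instance comp_proper Var (A B C : fma Var) :
  Proper (@doteq Var B C ==> @doteq Var A B ==> @doteq Var A C) (@comp Var A B C).
Proof. intros g g' Hg f f' Hf; now apply deq_comp. Qed.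

#[export] Instance tens_proper Var (A B C D : fma Var) :
  Proper (@doteq Var A C ==> @doteq Var B D ==> @doteq Var (A ⊗ B) (C ⊗ D))
    (@tens Var A B C D).
Proof. intros f f' Hf g g' Hg; now apply deq_tens. Qed.

#[export] Instance circeq_equivalence Var (S : stoup Var) Γ C :
  Equivalence (@circeq Var S Γ C).
Proof.
split.
- exact (@ceq_refl Var S Γ C).
- exact (@ceq_sym Var S Γ C).
- exact (@ceq_trans Var S Γ C).
Qed.

#[export] Instance TR_proper Var (S : stoup Var) Γ Δ A B :
  Proper (@circeq Var S Γ A ==> @circeq Var None Δ B ==> @circeq Var S (Γ ++ Δ) (A ⊗ B))
    (@TR Var S Γ Δ A B).
Proof. intros f f' Hf g g' Hg; now apply ceq_TR. Qed.

#[export] Instance pass_proper Var (A : fma Var) Γ C :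
  Proper (@circeq Var (Some A) Γ C ==> @circeq Var None (A :: Γ) C) (@pass Var A Γ C).
Proof. intros f f' Hf; now apply ceq_pass. Qed.

#[export] Instance IL_proper Var (Γ : ctx Var) C :
  Proper (@circeq Var None Γ C ==> @circeq Var (Some I) Γ C) (@IL Var Γ C).
Proof. intros f f' Hf; now apply ceq_IL. Qed.

#[export] Instance TL_proper Var (A B : fma Var) Γ C :
  Proper (@circeq Var (Some A) (B :: Γ) C ==> @circeq Var (Some (A ⊗ B)) Γ C)
    (@TL Var A B Γ C).
Proof. intros f f' Hf; now apply ceq_TL. Qed.

(** * Modules over the left rules, and freeness of derivations *)

(** [leq] is the equality of the module, not an order; carrying it avoids forming quotients. *)
Record left_module (Var : Type) : Type := {
  car :> stoup Var -> ctx Var -> Type;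
  leq : forall S Γ, car S Γ -> car S Γ -> Prop;
  lpass : forall A Γ, car (Some A) Γ -> car None (A :: Γ);
  lIL : forall Γ, car None Γ -> car (Some I) Γ;
  lTL : forall A B Γ, car (Some A) (B :: Γ) -> car (Some (A ⊗ B)) Γ;
  leq_equivalence : forall S Γ, Equivalence (@leq S Γ);
  lpass_proper : forall A Γ, Proper (@leq _ _ ==> @leq _ _) (@lpass A Γ);
  lIL_proper : forall Γ, Proper (@leq _ _ ==> @leq _ _) (@lIL Γ);
  lTL_proper : forall A B Γ, Proper (@leq _ _ ==> @leq _ _) (@lTL A B Γ) }.

#[export] Existing Instances leq_equivalence lpass_proper lIL_proper lTL_proper.

Record is_hom Var (C : fma Var) (M : left_module Var)
    (F : forall S Γ, S ∣ Γ ⊢ C -> M S Γ) : Prop := {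
  hom_proper : forall S Γ (x y : S ∣ Γ ⊢ C), x ≗ y -> leq (F _ _ x) (F _ _ y);
  hom_pass : forall A Γ (x : Some A ∣ Γ ⊢ C), leq (F _ _ (pass x)) (lpass (F _ _ x));
  hom_IL : forall Γ (x : None ∣ Γ ⊢ C), leq (F _ _ (IL x)) (lIL (F _ _ x));
  hom_TL : forall A B Γ (x : Some A ∣ B :: Γ ⊢ C),
    leq (F _ _ (TL x)) (lTL (F _ _ x)) }.

Program Definition cfmod Var (C : fma Var) : left_module Var :=
  {| car := fun S Γ => S ∣ Γ ⊢ C; leq := fun S Γ => @circeq Var S Γ C;
     lpass := fun A Γ f => pass f; lIL := fun Γ f => IL f;
     lTL := fun A B Γ f => TL f |}.

(* TR _ y, for y a derivation with context Δ, is a map of modules into a shift by Δ. *)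
Program Definition shift Var (Δ : ctx Var) (M : left_module Var) : left_module Var :=
  {| car := fun S Γ => M S (Γ ++ Δ); leq := fun S Γ => @leq _ M S (Γ ++ Δ);
     lpass := fun A Γ => @lpass _ M A (Γ ++ Δ); lIL := fun Γ => @lIL _ M (Γ ++ Δ);
     lTL := fun A B Γ => @lTL _ M A B (Γ ++ Δ) |}.

(* The data that determine a map of modules from the derivations of C to M. *)
Definition algebra Var (M : left_module Var) (C : fma Var) : Type :=
  match C with
  | Atom X => M (Some (Atom X)) []
  | I => M None []
  | A ⊗ B => forall S Γ Δ, S ∣ Γ ⊢ A -> None ∣ Δ ⊢ B -> M S (Γ ++ Δ)
  end.

(** At [TR] the algebra receives the premises themselves, not their images. An axiom at a compound
    formula is treated as its expansion, so [ceq_ax_I] and [ceq_ax_T] hold by computation. *)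
Fixpoint fold Var (M : left_module Var) S Γ C (x : S ∣ Γ ⊢ C) : algebra M C -> M S Γ :=
  match x in S ∣ Γ ⊢ C return algebra M C -> M S Γ with
  | ax C =>
      match C return algebra M C -> M (Some C) [] with
      | Atom X => fun e => e
      | I => fun e => lIL e
      | A ⊗ B => fun e => lTL (e _ _ _ (ax A) (pass (ax B)))
      end
  | pass x => fun e => lpass (fold x e)
  | IL x => fun e => lIL (fold x e)
  | IR => fun e => e
  | TL x => fun e => lTL (fold x e)
  | TR x y => fun e => e _ _ _ x y
  end.

(** For a tensor, the values must respect [≗] at [TR]: left rules permute out of the first premise,
    and both premises may be replaced by equivalent ones. *)
Definition good_algebra Var (M : left_module Var) (C : fma Var) : algebra M C -> Prop :=
  match C return algebra M C -> Prop with
  | A ⊗ B => fun e =>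
      (forall Δ (y : None ∣ Δ ⊢ B),
         is_hom (M := shift Δ M) (fun S Γ x => e S Γ Δ x y)) /\
      (forall S Γ Δ (x : S ∣ Γ ⊢ A) (y y' : None ∣ Δ ⊢ B),
         y ≗ y' -> leq (e _ _ _ x y) (e _ _ _ x y'))
  | _ => fun _ => True
  end.

(** Existence half of freeness. Left rules are respected by computation; for [≗], the equations at
    [TR] are the clauses of [good_algebra]. *)
Lemma fold_hom Var (M : left_module Var) C (e : algebra M C) :
  good_algebra e -> is_hom (fun S Γ x => fold x e).
Proof.
intros He; split; try reflexivity.
intros S Γ x y Hxy; revert e He.
induction Hxy; intros e He; cbn.
- reflexivity.
- symmetry; auto.
- etransitivity; auto.
- apply lpass_proper; auto.
- apply lIL_proper; auto.
- apply lTL_proper; auto.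
- destruct He as [He1 He2]; etransitivity.
  + apply (hom_proper (He1 _ g)); eassumption.
  + now apply He2.
- reflexivity.
- reflexivity.
- apply (hom_pass (proj1 He _ g)).
- apply (hom_IL (proj1 He _ g)).
- apply (hom_TL (proj1 He _ g)).
Qed.

Definition agree Var (M : left_module Var) (C : fma Var) :
    forall F G : (forall S Γ, S ∣ Γ ⊢ C -> M S Γ), Prop :=
  match C return forall F G : (forall S Γ, S ∣ Γ ⊢ C -> M S Γ), Prop with
  | Atom X => fun F G => leq (F _ _ (ax (Atom X))) (G _ _ (ax (Atom X)))
  | I => fun F G => leq (F _ _ IR) (G _ _ IR)
  | A ⊗ B => fun F G => forall S Γ Δ (x : S ∣ Γ ⊢ A) (y : None ∣ Δ ⊢ B),
      leq (F _ _ (TR x y)) (G _ _ (TR x y))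
  end.

(** Uniqueness half of freeness. Left rules reduce to their premises, and [ax] at a compound formula
    expands to a left rule applied to a right rule, where [agree] decides. *)
Lemma hom_ext Var (M : left_module Var) C (F G : forall S Γ, S ∣ Γ ⊢ C -> M S Γ) :
  is_hom F -> is_hom G -> agree F G -> forall S Γ x, leq (F S Γ x) (G S Γ x).
Proof.
intros HF HG HFG S Γ x; induction x.
- destruct A as [X| |A B]; cbn in HFG.
  + exact HFG.
  + rewrite (hom_proper HF (ceq_ax_I _)), (hom_proper HG (ceq_ax_I _)).
    rewrite (hom_IL HF), (hom_IL HG), HFG; reflexivity.
  + rewrite (hom_proper HF (ceq_ax_T _ _)), (hom_proper HG (ceq_ax_T _ _)).
    rewrite (hom_TL HF), (hom_TL HG); apply lTL_proper.
    exact (HFG _ [] [B] (ax A) (pass (ax B))).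
- rewrite (hom_pass HF), (hom_pass HG); apply lpass_proper; auto.
- rewrite (hom_IL HF), (hom_IL HG); apply lIL_proper; auto.
- exact HFG.
- rewrite (hom_TL HF), (hom_TL HG); apply lTL_proper; auto.
- apply HFG.
Qed.

(** * Transport of derivations along equalities of contexts *)

Definition cast Var (S : stoup Var) Γ Γ' C (e : Γ = Γ') : S ∣ Γ ⊢ C -> S ∣ Γ' ⊢ C :=
  match e with eq_refl => fun x => x end.

Lemma cast_id Var (S : stoup Var) Γ C (e : Γ = Γ) (x : S ∣ Γ ⊢ C) : cast e x = x.
Proof. now rewrite (proof_irrelevance _ e eq_refl). Qed.

Lemma cast_cast Var (S : stoup Var) Γ1 Γ2 Γ3 C (e : Γ1 = Γ2) (e' : Γ2 = Γ3)
    (x : S ∣ Γ1 ⊢ C) : cast e' (cast e x) = cast (eq_trans e e') x.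
Proof. now destruct e'. Qed.

#[export] Instance cast_proper Var (S : stoup Var) Γ Γ' C (e : Γ = Γ') :
  Proper (@circeq Var S Γ C ==> @circeq Var S Γ' C) (@cast Var S Γ Γ' C e).
Proof. intros x y Hxy; now destruct e. Qed.

Lemma cast_irrel Var (S : stoup Var) Γ Γ' C (e e' : Γ = Γ') (x y : S ∣ Γ ⊢ C) :
  x ≗ y -> cast e x ≗ cast e' y.
Proof. intros Hxy; rewrite (proof_irrelevance _ e' e), Hxy; reflexivity. Qed.

Lemma cast_irrel_l Var (S : stoup Var) Γ C (e : Γ = Γ) (x y : S ∣ Γ ⊢ C) :
  x ≗ y -> cast e x ≗ y.
Proof. now rewrite cast_id. Qed.

Lemma TR_cast_l Var (S : stoup Var) Γ Γ' Δ A B (e : Γ = Γ')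
    (x : S ∣ Γ ⊢ A) (y : None ∣ Δ ⊢ B) :
  TR (cast e x) y = cast (f_equal (fun Θ => Θ ++ Δ) e) (TR x y).
Proof. now destruct e. Qed.

Lemma TR_cast_r Var (S : stoup Var) Γ Δ Δ' A B (e : Δ = Δ')
    (x : S ∣ Γ ⊢ A) (y : None ∣ Δ ⊢ B) :
  TR x (cast e y) = cast (f_equal (app Γ) e) (TR x y).
Proof. now destruct e. Qed.

Lemma cast_pass Var (A : fma Var) Γ Γ' C (e : A :: Γ = A :: Γ') (x : Some A ∣ Γ ⊢ C) :
  cast e (pass x) = pass (cast (f_equal (@tl _) e) x).
Proof.
assert (e0 : Γ = Γ') by now injection e.
destruct e0; now rewrite !cast_id.
Qed.

Lemma cast_IL Var (Γ Γ' : ctx Var) C (e : Γ = Γ') (x : None ∣ Γ ⊢ C) :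
  cast e (IL x) = IL (cast e x).
Proof. now destruct e. Qed.

Lemma cast_TL Var (A B : fma Var) Γ Γ' C (e : Γ = Γ') (x : Some A ∣ B :: Γ ⊢ C) :
  cast e (TL x) = TL (cast (f_equal (cons B) e) x).
Proof. now destruct e. Qed.

(** * The action of categorical derivations on sequent derivations *)

Lemma TR_hom Var (A B : fma Var) Δ (y : None ∣ Δ ⊢ B) :
  is_hom (C := A) (M := shift Δ (cfmod (A ⊗ B))) (fun S Γ x => TR x y).
Proof.
split; cbn; intros.
- now apply ceq_TR.
- apply ceq_TR_pass.
- apply ceq_TR_IL.
- apply ceq_TR_TL.
Qed.

Lemma id_hom Var (A : fma Var) : is_hom (C := A) (M := cfmod A) (fun S Γ x => x).
Proof. split; cbn; intros; (assumption || reflexivity). Qed.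

Lemma comp_hom Var (A B : fma Var) (M : left_module Var)
    (F : forall S Γ, S ∣ Γ ⊢ A -> S ∣ Γ ⊢ B) (G : forall S Γ, S ∣ Γ ⊢ B -> M S Γ) :
  is_hom (M := cfmod B) F -> is_hom G -> is_hom (fun S Γ x => G S Γ (F S Γ x)).
Proof.
intros HF HG; split; intros.
- now apply (hom_proper HG), (hom_proper HF).
- rewrite (hom_proper HG (hom_pass HF x)); apply (hom_pass HG).
- rewrite (hom_proper HG (hom_IL HF x)); apply (hom_IL HG).
- rewrite (hom_proper HG (hom_TL HF x)); apply (hom_TL HG).
Qed.

(** With [F] equal to [TR _ z] or an inner fold, this allows an equation on [TR y z] to be tested
    again on [y]. *)
Lemma comp_shift_hom Var (A B : fma Var) (M : left_module Var) Δ
    (F : forall S Γ, S ∣ Γ ⊢ A -> S ∣ Γ ++ Δ ⊢ B) (G : forall S Γ, S ∣ Γ ⊢ B -> M S Γ) :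
  is_hom (M := shift Δ (cfmod B)) F -> is_hom G ->
  is_hom (M := shift Δ M) (fun S Γ x => G S (Γ ++ Δ) (F S Γ x)).
Proof.
intros HF HG; split; intros.
- now apply (hom_proper HG), (hom_proper HF).
- pose proof (hom_proper HG (hom_pass HF x)) as E; cbn in *.
  rewrite E; apply (hom_pass HG).
- pose proof (hom_proper HG (hom_IL HF x)) as E; cbn in *.
  rewrite E; apply (hom_IL HG).
- pose proof (hom_proper HG (hom_TL HF x)) as E; cbn in *.
  rewrite E; apply (hom_TL HG).
Qed.

(** [lam] puts the second premise in place of [IR] in the first; [alpha] rebrackets [TR (TR u v) z]
    as [TR u (TR v z)]. Both reach into the first premise by an inner fold into a shift by the
    context of [z]. *)
Fixpoint act Var (A B : fma Var) (h : A ⇒ B) : forall S Γ, S ∣ Γ ⊢ A -> S ∣ Γ ⊢ B :=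
  match h in A ⇒ B return forall S Γ, S ∣ Γ ⊢ A -> S ∣ Γ ⊢ B with
  | idc A => fun S Γ x => x
  | comp g f => fun S Γ x => act g (act f x)
  | tens f g => fun S Γ x =>
      fold (M := cfmod _) (C := _ ⊗ _) x (fun S Γ Δ y z => TR (act f y) (act g z))
  | lam A => fun S Γ x =>
      fold (M := cfmod A) (C := _ ⊗ _) x
        (fun S Γ Δ y z => fold (M := shift Δ (cfmod A)) (C := I) y z)
  | rho A => fun S Γ x => cast (app_nil_r Γ) (TR x IR)
  | alpha A B C => fun S Γ x =>
      fold (M := cfmod (A ⊗ (B ⊗ C))) (C := A ⊗ B ⊗ C) x
        (fun S Γ Δ y z => fold (M := shift Δ (cfmod (A ⊗ (B ⊗ C)))) (C := A ⊗ B) y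
          (fun S' Γ1 Γ2 u v => cast (app_assoc Γ1 Γ2 Δ) (TR u (TR v z))))
  end.

Lemma act_cast Var (A B : fma Var) (h : A ⇒ B) S Γ Γ' (e : Γ = Γ') (x : S ∣ Γ ⊢ A) :
  act h (cast e x) = cast e (act h x).
Proof. now destruct e. Qed.

Lemma rho_hom Var (A : fma Var) :
  is_hom (C := A) (M := cfmod (A ⊗ I)) (fun S Γ x => act (rho A) x).
Proof.
split; cbn; intros.
- now rewrite H.
- rewrite ceq_TR_pass, cast_pass.
  apply ceq_pass; now apply cast_irrel.
- now rewrite ceq_TR_IL, cast_IL.
- rewrite ceq_TR_TL, cast_TL. apply ceq_TL; now apply cast_irrel.
Qed.

Lemma lam_hom Var (A : fma Var) Δ (y : None ∣ Δ ⊢ A) :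
  is_hom (C := I) (M := shift Δ (cfmod A)) 
    (fun S Γ x => fold (M := shift Δ (cfmod A)) (C := I) x y).
Proof. now apply fold_hom. Qed.

Lemma alpha_hom Var (A B C : fma Var) Δ (z : None ∣ Δ ⊢ C) :
  is_hom (C := A ⊗ B) (M := shift Δ (cfmod (A ⊗ (B ⊗ C))))
    (fun S Γ x => fold (M := shift Δ (cfmod (A ⊗ (B ⊗ C)))) (C := A ⊗ B) x
       (fun S Γ1 Γ2 u v => cast (app_assoc Γ1 Γ2 Δ) (TR u (TR v z)))).
Proof.
apply fold_hom; split.
- intros Θ y; split; cbn; intros.
  + now rewrite H.
  + rewrite ceq_TR_pass, cast_pass.
    apply ceq_pass; now apply cast_irrel.
  + now rewrite ceq_TR_IL, cast_IL.
  + rewrite ceq_TR_TL, cast_TL. apply ceq_TL; now apply cast_irrel.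
- intros; cbn; now rewrite H.
Qed.

Lemma act_hom Var (A B : fma Var) (h : A ⇒ B) :
  is_hom (M := cfmod B) (fun S Γ x => act h x).
Proof.
induction h.
- apply id_hom.
- cbn; now apply (comp_hom IHh2).
- apply fold_hom; split.
  + intros Δ y.
    apply (comp_hom (M := shift Δ (cfmod (C ⊗ D))) IHh1 (TR_hom C (act h2 y))).
  + intros; cbn; now rewrite (hom_proper IHh2 H).
- apply fold_hom; split.
  + intros; apply lam_hom.
  + intros S Γ Δ x y y' H.
    (* Congruence in the second premise is again uniqueness: both inner folds are maps of modules
       out of [I], compared at [IR]. *)
    apply (hom_ext (lam_hom y) (lam_hom y')); exact H.
- apply rho_hom.
- apply fold_hom; split.
  + intros; apply alpha_hom.
  + intros S Γ Δ x z z' H.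
    apply (hom_ext (alpha_hom A B z) (alpha_hom A B z')).
    intros S' Γ1 Γ2 u v; cbn; now rewrite H.
Qed.

#[export] Instance act_proper Var (A B : fma Var) (h : A ⇒ B) S Γ :
  Proper (@circeq Var S Γ A ==> @circeq Var S Γ B) (@act Var A B h S Γ).
Proof. intros x y; apply (hom_proper (act_hom h)). Qed.

(** The two shifts differ by associativity of [++] only, and the cast passes through every left
    rule. *)
Lemma shift_shift_hom Var (A B : fma Var) Δ Δ'
    (F : forall S Γ, S ∣ Γ ⊢ A -> S ∣ Γ ++ (Δ ++ Δ') ⊢ B) :
  is_hom (M := shift (Δ ++ Δ') (cfmod B)) F ->
  is_hom (M := shift Δ (shift Δ' (cfmod B)))
    (fun S Γ x => cast (app_assoc Γ Δ Δ') (F S Γ x)).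
Proof.
intros HF; split; cbn; intros.
- now rewrite (hom_proper HF H).
- rewrite (hom_pass HF x); cbn; rewrite cast_pass.
  apply ceq_pass; now apply cast_irrel.
- rewrite (hom_IL HF x); cbn; now rewrite cast_IL.
- rewrite (hom_TL HF x); cbn; rewrite cast_TL.
  apply ceq_TL; now apply cast_irrel.
Qed.

(** Apart from equations that hold by computation and the naturality of [rho], each generating
    equation is tested on right rules by [hom_ext]. Where it takes a premise apart further, the test
    is repeated on that premise; what remains agrees up to transport. *)
Lemma act_doteq Var (A B : fma Var) (f g : A ⇒ B) :
  f ≐ g -> forall S Γ (x : S ∣ Γ ⊢ A), act f x ≗ act g x.
Proof.
induction 1; intros S Γ x; try (cbn; reflexivity).
- now symmetry.
- now transitivity (act g x).
- cbn; now rewrite IHdoteq1, IHdoteq2.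
- apply (hom_ext (act_hom (f ⊗c g)) (act_hom (f' ⊗c g'))).
  intros S' Γ1 Γ2 y z; cbn; now rewrite IHdoteq1, IHdoteq2.
- apply (hom_ext (act_hom (idc A ⊗c idc B)) (act_hom (idc (A ⊗ B)))).
  intros S' Γ1 Γ2 y z; reflexivity.
- apply (hom_ext (act_hom ((h ∘ f) ⊗c (k ∘ g))) (act_hom ((h ⊗c k) ∘ (f ⊗c g)))).
  intros S' Γ1 Γ2 y z; reflexivity.
- apply (hom_ext (act_hom (lam B ∘ (idc I ⊗c f))) (act_hom (f ∘ lam A))).
  intros S' Γ1 Γ2 y z; cbn.
  apply (hom_ext (lam_hom (act f z)) (comp_shift_hom (lam_hom z) (act_hom f))).
  cbn; reflexivity.
- change (act (f ⊗c idc I) (cast (app_nil_r Γ) (TR x IR)) ≗ act (rho B) (act f x)).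
  now rewrite act_cast.
- apply (hom_ext (act_hom ((f ⊗c (g ⊗c h)) ∘ alpha A B C))
    (act_hom (alpha A' B' C' ∘ ((f ⊗c g) ⊗c h)))).
  intros S' Γ1 Γ2 y z; cbn.
  apply (hom_ext (comp_shift_hom (alpha_hom A B z) (act_hom (f ⊗c (g ⊗c h))))
    (comp_hom (act_hom (f ⊗c g)) (alpha_hom A' B' (act h z)))).
  intros S'' Γ3 Γ4 u v.
  change (act (f ⊗c (g ⊗c h)) (cast (app_assoc Γ3 Γ4 Γ2) (TR u (TR v z))) ≗
    cast (app_assoc Γ3 Γ4 Γ2) (TR (act f u) (TR (act g v) (act h z)))).
  now rewrite act_cast.
- apply (hom_ext (act_hom (lam I ∘ rho I)) (act_hom (idc I))).
  cbn; now rewrite cast_id.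
- apply (hom_ext (act_hom ((idc A ⊗c lam B) ∘ alpha A I B ∘ (rho A ⊗c idc B)))
    (act_hom (idc (A ⊗ B)))).
  intros S' Γ1 Γ2 y z.
  change (act ((idc A ⊗c lam B) ∘ alpha A I B) (TR (cast (app_nil_r Γ1) (TR y IR)) z)
    ≗ TR y z).
  rewrite TR_cast_l, act_cast.
  change (act ((idc A ⊗c lam B) ∘ alpha A I B) (TR (TR y IR) z))
    with (act (idc A ⊗c lam B) (cast (app_assoc Γ1 [] Γ2) (TR y (TR IR z)))).
  rewrite act_cast, cast_cast; now apply cast_irrel_l.
- apply (hom_ext (act_hom (lam (A ⊗ B) ∘ alpha I A B)) (act_hom (lam A ⊗c idc B))).
  intros S' Γ1 Γ2 y z; cbn.
  apply (hom_ext (comp_shift_hom (alpha_hom I A z) (act_hom (lam (A ⊗ B))))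
    (comp_hom (act_hom (lam A)) (TR_hom _ z))).
  intros S'' Γ3 Γ4 u v.
  change (act (lam (A ⊗ B)) (cast (app_assoc Γ3 Γ4 Γ2) (TR u (TR v z)))
    ≗ TR (act (lam A) (TR u v)) z).
  rewrite act_cast.
  (* Third test, on [u], which ends in [I]: at [IR] both sides are [TR v z] up to transport. *)
  apply (hom_ext (shift_shift_hom (lam_hom (TR v z)))
    (comp_shift_hom (lam_hom v) (TR_hom _ z))).
  cbn; now rewrite cast_id.
- apply (hom_ext (act_hom (alpha A B I ∘ rho (A ⊗ B))) (act_hom (idc A ⊗c rho B))).
  intros S' Γ1 Γ2 y z; cbn.
  change (act (alpha A B I) (cast (app_nil_r (Γ1 ++ Γ2)) (TR (TR y z) IR))
    ≗ TR y (cast (app_nil_r Γ2) (TR z IR))).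
  rewrite TR_cast_r, act_cast; cbn; rewrite cast_cast; now apply cast_irrel.
(* Three nested tests open [((A ⊗ B) ⊗ C) ⊗ D] into premises [u], [v], [z], [w]; both sides become
   [TR u (TR v (TR z w))] up to transport. *)
- apply (hom_ext (act_hom (alpha A B (C ⊗ D) ∘ alpha (A ⊗ B) C D))
    (act_hom ((idc A ⊗c alpha B C D) ∘ alpha A (B ⊗ C) D ∘ (alpha A B C ⊗c idc D)))).
  intros S1 Γ1 Δ1 q w.
  apply (hom_ext
    (comp_shift_hom (alpha_hom (A ⊗ B) C w) (act_hom (alpha A B (C ⊗ D))))
    (comp_hom (act_hom (alpha A B C)) (comp_shift_hom (TR_hom _ w)
      (act_hom ((idc A ⊗c alpha B C D) ∘ alpha A (B ⊗ C) D))))).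
  intros S2 Γ2 Δ2 r z.
  change (act (alpha A B (C ⊗ D)) (cast (app_assoc Γ2 Δ2 Δ1) (TR r (TR z w))) ≗
    act ((idc A ⊗c alpha B C D) ∘ alpha A (B ⊗ C) D) (TR (act (alpha A B C) (TR r z)) w)).
  rewrite act_cast.
  apply (hom_ext (shift_shift_hom (alpha_hom A B (TR z w)))
    (comp_shift_hom (alpha_hom A B z) (comp_shift_hom (TR_hom _ w)
      (act_hom ((idc A ⊗c alpha B C D) ∘ alpha A (B ⊗ C) D))))).
  intros S3 Γ3 Δ3 u v.
  change (cast (app_assoc (Γ3 ++ Δ3) Δ2 Δ1)
      (cast (app_assoc Γ3 Δ3 (Δ2 ++ Δ1)) (TR u (TR v (TR z w)))) ≗
    act ((idc A ⊗c alpha B C D) ∘ alpha A (B ⊗ C) D)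
      (TR (cast (app_assoc Γ3 Δ3 Δ2) (TR u (TR v z))) w)).
  rewrite TR_cast_l, act_cast.
  change (act ((idc A ⊗c alpha B C D) ∘ alpha A (B ⊗ C) D) (TR (TR u (TR v z)) w))
    with (act (idc A ⊗c alpha B C D)
      (cast (app_assoc Γ3 (Δ3 ++ Δ2) Δ1) (TR u (TR (TR v z) w)))).
  rewrite act_cast; cbn; rewrite TR_cast_r, !cast_cast; now apply cast_irrel.
Qed.

(** * Naturality and coherence of [imap], [psi] and [phi'] *)

Lemma comp_idr Var (A B : fma Var) (f : A ⇒ B) : f ∘ idc A ≐ f.
Proof. apply deq_idr. Qed.

Lemma comp_idl Var (A B : fma Var) (f : A ⇒ B) : idc B ∘ f ≐ f.
Proof. symmetry; apply deq_idl. Qed.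

Lemma comp_assoc Var (A B C D : fma Var) (f : A ⇒ B) (g : B ⇒ C) (h : C ⇒ D) :
  h ∘ g ∘ f ≐ h ∘ (g ∘ f).
Proof. symmetry; apply deq_assoc. Qed.

Lemma tens_comp Var (A B C A' B' C' : fma Var)
    (f : A ⇒ B) (h : B ⇒ C) (g : A' ⇒ B') (k : B' ⇒ C') :
  (h ⊗c k) ∘ (f ⊗c g) ≐ (h ∘ f) ⊗c (k ∘ g).
Proof. symmetry; apply deq_tens_comp. Qed.

#[export] Instance imap_proper Var (A B : fma Var) :
  Proper (@doteq Var A B ==> forall_relation (fun Γ => @doteq Var (ictx A Γ) (ictx B Γ)))
    (@imap Var A B).
Proof.
intros f g H Γ; revert A B f g H; induction Γ as [|C Γ IH]; cbn; intros A B f g H.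
- exact H.
- apply IH; now rewrite H.
Qed.

Lemma imap_id Var (A : fma Var) Γ : imap (idc A) Γ ≐ idc (ictx A Γ).
Proof.
revert A; induction Γ as [|C Γ IH]; cbn; intros A; [reflexivity|].
rewrite <- IH; apply imap_proper, deq_tens_id.
Qed.

Lemma imap_comp Var (A B C : fma Var) (f : A ⇒ B) (g : B ⇒ C) Γ :
  imap (g ∘ f) Γ ≐ imap g Γ ∘ imap f Γ.
Proof.
revert A B C f g; induction Γ as [|D Γ IH]; cbn; intros; [reflexivity|].
rewrite <- IH; apply imap_proper; rewrite tens_comp, comp_idr; reflexivity.
Qed.

Lemma psi_natural_l Var (A A' B : fma Var) (f : A ⇒ A') Γ :
  psi A' B Γ ∘ imap (f ⊗c idc B) Γ ≐ (f ⊗c idc (ictx B Γ)) ∘ psi A B Γ.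
Proof.
revert B; induction Γ as [|C Γ IH]; cbn; intros B.
- now rewrite comp_idl, comp_idr.
- rewrite comp_assoc, <- imap_comp, deq_assoc, <- IH, comp_assoc, <- imap_comp.
  apply deq_comp; [reflexivity|]; apply imap_proper.
  rewrite <- deq_alpha, deq_tens_id; reflexivity.
Qed.

Lemma psi_natural_r Var (A B B' : fma Var) (f : B ⇒ B') Γ :
  psi A B' Γ ∘ imap (idc A ⊗c f) Γ ≐ (idc A ⊗c imap f Γ) ∘ psi A B Γ.
Proof.
revert B B' f; induction Γ as [|C Γ IH]; cbn; intros B B' f.
- now rewrite comp_idl, comp_idr.
- rewrite comp_assoc, <- imap_comp, deq_assoc, <- IH, comp_assoc, <- imap_comp.
  apply deq_comp; [reflexivity|]; apply imap_proper.
  rewrite <- deq_alpha; reflexivity.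
Qed.

Lemma phi'_natural Var (A A' : fma Var) (f : A ⇒ A') Γ Δ :
  phi' A' Γ Δ ∘ imap f (Γ ++ Δ) ≐ (imap f Γ ⊗c idc (iante None Δ)) ∘ phi' A Γ Δ.
Proof.
revert A A' f; induction Γ as [|C Γ IH]; cbn; intros A A' f.
- rewrite comp_assoc, <- imap_comp, deq_assoc.
  unfold iante; cbn; rewrite <- psi_natural_l, comp_assoc, <- imap_comp.
  apply deq_comp; [reflexivity|]; apply imap_proper.
  symmetry; apply deq_rho.
- apply IH.
Qed.

Lemma lam_psi Var (B : fma Var) Γ : lam (ictx B Γ) ∘ psi I B Γ ≐ imap (lam B) Γ.
Proof.
revert B; induction Γ as [|C Γ IH]; cbn; intros B.
- apply comp_idr.
- rewrite deq_assoc, IH, <- imap_comp; apply imap_proper, deq_lam_alpha.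
Qed.

Lemma lam_phi Var (Δ : ctx Var) : lam (iante None Δ) ∘ phi None [] Δ ≐ idc (iante None Δ).
Proof.
unfold phi, iante; cbn.
rewrite deq_assoc, lam_psi, <- imap_comp, <- imap_id.
apply imap_proper, deq_lam_rho.
Qed.

(** The pentagon axiom iterated along [Δ], one instance for each formula. *)
Lemma psi_pentagon Var (A B C : fma Var) Δ :
  (idc A ⊗c psi B C Δ) ∘ (psi A (B ⊗ C) Δ ∘ imap (alpha A B C) Δ) ≐
  alpha A B (ictx C Δ) ∘ psi (A ⊗ B) C Δ.
Proof.
revert C; induction Δ as [|D Δ IH]; cbn; intros C.
- now rewrite deq_tens_id, !comp_idl, comp_idr.
- rewrite (deq_assoc (imap _ _) (psi _ _ _) (alpha _ _ _)), <- IH.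
  rewrite !comp_assoc, <- !imap_comp.
  (* The pentagon under [imap]; [psi_natural_r] then carries [alpha B C D] out past [psi]. *)
  assert (E : psi A (B ⊗ (C ⊗ D)) Δ ∘ imap (alpha A B (C ⊗ D) ∘ alpha (A ⊗ B) C D) Δ ≐
      (idc A ⊗c imap (alpha B C D) Δ) ∘
      (psi A (B ⊗ C ⊗ D) Δ ∘ imap (alpha A (B ⊗ C) D ∘ (alpha A B C ⊗c idc D)) Δ)).
  { rewrite (deq_assoc _ _ (idc A ⊗c _)), <- psi_natural_r, comp_assoc, <- imap_comp.
    apply deq_comp; [reflexivity|]; apply imap_proper.
    rewrite deq_assoc; apply deq_pentagon. }
  rewrite E, (deq_assoc _ (idc A ⊗c _)), tens_comp, comp_idl; reflexivity.
Qed.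

(** For empty [Γ] this is [psi_pentagon] with [deq_alpha_rho]; further formulae are absorbed by
    naturality of [phi']. *)
Lemma psi_phi' Var (A B : fma Var) Γ Δ :
  (idc A ⊗c phi' B Γ Δ) ∘ psi A B (Γ ++ Δ) ≐
  alpha A (ictx B Γ) (iante None Δ) ∘ (psi A B Γ ⊗c idc _) ∘ phi' (A ⊗ B) Γ Δ.
Proof.
revert B; induction Γ as [|C Γ IH]; cbn; intros B.
- unfold iante; cbn.
  rewrite deq_tens_id, comp_idr, deq_assoc, <- psi_pentagon.
  rewrite !comp_assoc, <- imap_comp, (imap_proper (deq_alpha_rho A B) Δ).
  rewrite psi_natural_r, deq_assoc, tens_comp, comp_idl; reflexivity.
- rewrite deq_assoc, IH, comp_assoc, phi'_natural.
  rewrite !comp_assoc, (deq_assoc (phi' _ _ _)), tens_comp, comp_idl; reflexivity.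
Qed.

(** * Splitting of contexts, up to transport of the domain *)

Definition dcast Var (A A' C : fma Var) (e : A = A') : A ⇒ C -> A' ⇒ C :=
  match e with eq_refl => fun f => f end.

Lemma dcast_id Var (A C : fma Var) (e : A = A) (f : A ⇒ C) : dcast e f = f.
Proof. now rewrite (proof_irrelevance _ e eq_refl). Qed.

Lemma dcast_dcast Var (A1 A2 A3 C : fma Var) (e : A1 = A2) (e' : A2 = A3) (f : A1 ⇒ C) :
  dcast e' (dcast e f) = dcast (eq_trans e e') f.
Proof. now destruct e'. Qed.

#[export] Instance dcast_proper Var (A A' C : fma Var) (e : A = A') :
  Proper (@doteq Var A C ==> @doteq Var A' C) (@dcast Var A A' C e).
Proof. intros f g H; now destruct e. Qed.

Lemma dcast_comp Var (A A' B C : fma Var) (e : A = A') (g : B ⇒ C) (f : A ⇒ B) :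
  dcast e (g ∘ f) = g ∘ dcast e f.
Proof. now destruct e. Qed.

Lemma imap_dcast Var (A A' B : fma Var) (e : A = A') (f : A ⇒ B) Γ :
  imap (dcast e f) Γ = dcast (f_equal (fun X => ictx X Γ) e) (imap f Γ).
Proof. now destruct e. Qed.

Lemma sound_cast Var (S : stoup Var) Γ Γ' C (e : Γ = Γ') (x : S ∣ Γ ⊢ C) :
  sound (cast e x) = dcast (f_equal (iante S) e) (sound x).
Proof. now destruct e. Qed.

(** Induction on [Γ1] down to [psi_phi']. The equality [e] is arbitrary so that the induction leaves
    it unchanged; at [[]] its two sides are convertible. This is how [sound] sees the action of
    [alpha]. *)
Lemma phi'_assoc Var (A : fma Var) Γ1 Γ2 Δ
    (e : ictx A (Γ1 ++ Γ2 ++ Δ) = ictx A ((Γ1 ++ Γ2) ++ Δ)) :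
  (idc _ ⊗c phi' I Γ2 Δ) ∘ dcast e (phi' A Γ1 (Γ2 ++ Δ)) ≐
  alpha _ _ _ ∘ (phi' A Γ1 Γ2 ⊗c idc _) ∘ phi' A (Γ1 ++ Γ2) Δ.
Proof.
revert A e; induction Γ1 as [|C Γ1 IH]; cbn; intros A e.
- rewrite dcast_id, deq_assoc, psi_phi', comp_assoc, phi'_natural.
  rewrite !comp_assoc, (deq_assoc (phi' _ _ _)), tens_comp, comp_idl; reflexivity.
- apply IH.
Qed.

Lemma phi'_nil_r Var (A : fma Var) Γ (e : ictx A (Γ ++ []) = ictx A Γ) :
  dcast e (phi' A Γ []) ≐ rho (ictx A Γ).
Proof.
revert A e; induction Γ as [|C Γ IH]; cbn; intros A e.
- rewrite dcast_id; apply comp_idl.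
- apply IH.
Qed.

(** The base case is the axiom [deq_lam_alpha_rho]. This serves to evaluate [sound] on
    [TR x (pass (ax B))]. *)
Lemma phi'_single Var (A B : fma Var) Γ (e : ictx A (Γ ++ [B]) = ictx A Γ ⊗ B) :
  (idc _ ⊗c lam B) ∘ dcast e (phi' A Γ [B]) ≐ idc _.
Proof.
revert A e; induction Γ as [|C Γ IH]; cbn; intros A e.
- rewrite dcast_id, comp_idl, deq_assoc; apply deq_lam_alpha_rho.
- apply IH.
Qed.

(** * The translation [sound] as a map of modules *)

(** [lIL] and [lTL] can be identities because the antecedents they relate have convertible
    interpretations. *)
Program Definition hom_mod Var (C : fma Var) : left_module Var :=
  {| car := fun S Γ => iante S Γ ⇒ C; leq := fun S Γ => @doteq Var (iante S Γ) C;
     lpass := fun A Γ f => f ∘ imap (lam A) Γ;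
     lIL := fun Γ f => f; lTL := fun A B Γ f => f |}.
Next Obligation. intros f g H; now apply deq_comp. Qed.
Next Obligation. now intros f g H. Qed.
Next Obligation. now intros f g H. Qed.

(** Two generating equations do not hold by computation: the expansion of [ax] at a tensor, which is
    [phi'_single], and the permutation of [pass] with [TR], which is naturality of [phi']. *)
Lemma sound_circeq Var (S : stoup Var) Γ C (x y : S ∣ Γ ⊢ C) :
  x ≗ y -> sound x ≐ sound y.
Proof.
induction 1; cbn; try assumption; try reflexivity.
- now symmetry.
- now transitivity (sound g).
- now rewrite IHcirceq.
- now rewrite IHcirceq1, IHcirceq2.
- symmetry; rewrite comp_idl; exact (phi'_single (Γ := []) eq_refl).
- unfold phi; cbn; rewrite comp_assoc.
  transitivity ((sound f ⊗c sound g) ∘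
    ((imap (lam A) Γ ⊗c idc (iante None Δ)) ∘ phi' (I ⊗ A) Γ Δ)).
  + rewrite deq_assoc, tens_comp, comp_idr; reflexivity.
  + apply deq_comp; [reflexivity|]; symmetry; apply phi'_natural.
Qed.

Lemma sound_hom Var (C : fma Var) : is_hom (M := hom_mod C) (fun S Γ x => sound x).
Proof. split; intros; try reflexivity; now apply sound_circeq. Qed.

Lemma postcomp_hom Var (B C : fma Var) (h : B ⇒ C) :
  is_hom (M := hom_mod C) (fun S Γ (x : S ∣ Γ ⊢ B) => h ∘ sound x).
Proof.
split; cbn; intros; try reflexivity.
- now rewrite (sound_circeq H).
- apply deq_assoc.
Qed.

(** Where [h] acts by a fold, both sides are compared on right rules as maps into [hom_mod]. The
    inputs are [lam_phi] for [lam], [phi'_nil_r] for [rho] and [phi'_assoc] for [alpha]. *)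
Lemma sound_act Var (A B : fma Var) (h : A ⇒ B) S Γ (x : S ∣ Γ ⊢ A) :
  sound (act h x) ≐ h ∘ sound x.
Proof.
revert S Γ x; induction h; intros S Γ x.
- cbn; now rewrite comp_idl.
- cbn; now rewrite IHh1, IHh2, deq_assoc.
- apply (hom_ext (comp_hom (act_hom (h1 ⊗c h2)) (sound_hom _)) (postcomp_hom (h1 ⊗c h2))).
  intros S' Γ1 Γ2 y z; cbn.
  now rewrite IHh1, IHh2, deq_tens_comp, comp_assoc.
- apply (hom_ext (comp_hom (act_hom (lam A)) (sound_hom _)) (postcomp_hom (lam A))).
  intros S' Γ1 Γ2 y z.
  apply (hom_ext (comp_shift_hom (lam_hom z) (sound_hom _))
    (comp_shift_hom (TR_hom _ z) (postcomp_hom (lam A)))).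
  cbn; rewrite deq_assoc, deq_lam, comp_assoc; symmetry.
  etransitivity; [|apply comp_idr]; apply deq_comp; [reflexivity|]; apply lam_phi.
- cbn; rewrite sound_cast; cbn; rewrite dcast_comp; unfold phi.
  etransitivity; [|apply deq_rho]; apply deq_comp; [reflexivity|]; apply phi'_nil_r.
- apply (hom_ext (comp_hom (act_hom (alpha A B C)) (sound_hom _))
    (postcomp_hom (alpha A B C))).
  intros S' Γ1 Γ2 y z.
  apply (hom_ext (comp_shift_hom (alpha_hom A B z) (sound_hom _))
    (comp_shift_hom (TR_hom _ z) (postcomp_hom (alpha A B C)))).
  intros S'' Γ3 Γ4 u v; cbn.
  rewrite sound_cast; cbn; rewrite dcast_comp; unfold phi; cbn.
  transitivity ((sound u ⊗c (sound v ⊗c sound z)) ∘ ((idc _ ⊗c phi' I Γ4 Γ2) ∘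
    dcast (f_equal (iante S'') (app_assoc Γ3 Γ4 Γ2))
      (phi' (istoup S'') Γ3 (Γ4 ++ Γ2)))).
  + rewrite deq_assoc, tens_comp, comp_idr; reflexivity.
  + etransitivity; [apply deq_comp; [reflexivity|]; apply phi'_assoc|].
    rewrite !comp_assoc, !deq_assoc, deq_alpha, !comp_assoc.
    apply deq_comp; [reflexivity|].
    rewrite deq_assoc, tens_comp, comp_idr; reflexivity.
Qed.

(** * Canonical derivations and the action on them *)

(** The counterpart of [imap] on derivations, with the accumulating recursion of [ictx]. *)
Fixpoint ext Var (S : stoup Var) Γ0 A (Γ : ctx Var) :
    S ∣ Γ0 ⊢ A -> S ∣ Γ0 ++ Γ ⊢ ictx A Γ :=
  match Γ with
  | [] => fun x => cast (eq_sym (app_nil_r Γ0)) x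
  | C :: Γ' => fun x =>
      cast (eq_sym (app_assoc Γ0 [C] Γ')) (ext Γ' (TR x (pass (ax C))))
  end.

Lemma ext_hom Var (A : fma Var) Γ :
  is_hom (C := A) (M := shift Γ (cfmod (ictx A Γ))) (fun S Γ0 x => ext Γ x).
Proof.
revert A; induction Γ as [|C Γ IH]; intros A.
- split; cbn; intros.
  + now rewrite H.
  + rewrite cast_pass; apply ceq_pass; now apply cast_irrel.
  + now rewrite cast_IL.
  + rewrite cast_TL; apply ceq_TL; now apply cast_irrel.
- pose proof (comp_shift_hom (TR_hom A (pass (ax C))) (IH (A ⊗ C))) as H.
  split; cbn; intros.
  + apply cast_proper; now apply (hom_proper H).
  + rewrite (hom_pass H x); cbn; rewrite cast_pass.
    apply ceq_pass; now apply cast_irrel.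
  + rewrite (hom_IL H x); cbn; now rewrite cast_IL.
  + rewrite (hom_TL H x); cbn; rewrite cast_TL.
    apply ceq_TL; now apply cast_irrel.
Qed.

#[export] Instance ext_proper Var (S : stoup Var) Γ0 A Γ :
  Proper (@circeq Var S Γ0 A ==> @circeq Var S (Γ0 ++ Γ) (ictx A Γ)) (@ext Var S Γ0 A Γ).
Proof. intros x y H; apply (hom_proper (ext_hom A Γ) H). Qed.

Lemma ext_cast Var (S : stoup Var) Γ0 Γ1 A Γ (e : Γ0 = Γ1) (x : S ∣ Γ0 ⊢ A) :
  ext Γ (cast e x) = cast (f_equal (fun Θ => Θ ++ Γ) e) (ext Γ x).
Proof. now destruct e. Qed.

Lemma act_imap_ext Var (A B : fma Var) (h : A ⇒ B) Γ S Γ0 (x : S ∣ Γ0 ⊢ A) :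
  act (imap h Γ) (ext Γ x) ≗ ext Γ (act h x).
Proof.
revert A B h Γ0 x; induction Γ as [|C Γ IH]; cbn; intros A B h Γ0 x.
- now rewrite act_cast.
- now rewrite act_cast, IH.
Qed.

Lemma act_psi_ext Var (A B : fma Var) Δ S Γ1 Γ2 (x : S ∣ Γ1 ⊢ A) (y : None ∣ Γ2 ⊢ B) :
  act (psi A B Δ) (ext Δ (TR x y)) ≗ cast (app_assoc Γ1 Γ2 Δ) (TR x (ext Δ y)).
Proof.
revert B Γ2 y; induction Δ as [|C Δ IH]; intros B Γ2 y.
- change (ext [] y) with (cast (eq_sym (app_nil_r Γ2)) y).
  rewrite TR_cast_r, cast_cast; now apply cast_irrel.
- change (act (psi A (B ⊗ C) Δ) (act (imap (alpha A B C) Δ)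
      (cast (eq_sym (app_assoc (Γ1 ++ Γ2) [C] Δ)) (ext Δ (TR (TR x y) (pass (ax C)))))) ≗
    cast (app_assoc Γ1 Γ2 (C :: Δ)) (TR x
      (cast (eq_sym (app_assoc Γ2 [C] Δ)) (ext Δ (TR y (pass (ax C))))))).
  rewrite !act_cast, act_imap_ext.
  change (act (alpha A B C) (TR (TR x y) (pass (ax C))))
    with (cast (app_assoc Γ1 Γ2 [C]) (TR x (TR y (pass (ax C))))).
  rewrite ext_cast, act_cast, IH, TR_cast_r, !cast_cast; now apply cast_irrel.
Qed.

(** [rho] creates the [IR] and [psi] moves [Δ] onto it. For [x] equal to [base S], this splits
    [univ S (Γ ++ Δ)] into [univ S Γ] and [univ None Δ], as the [TR] case of [act_sound_univ]
    requires. *)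
Lemma act_phi'_ext Var (A : fma Var) Γ Δ S Γ0 (x : S ∣ Γ0 ⊢ A) :
  act (phi' A Γ Δ) (ext (Γ ++ Δ) x) ≗
  cast (eq_sym (app_assoc Γ0 Γ Δ)) (TR (ext Γ x) (ext Δ IR)).
Proof.
revert A Γ0 x; induction Γ as [|C Γ IH]; intros A Γ0 x.
- change (act (psi A I Δ) (act (imap (rho A) Δ) (ext Δ x)) ≗
    cast (eq_sym (app_assoc Γ0 [] Δ)) (TR (cast (eq_sym (app_nil_r Γ0)) x) (ext Δ IR))).
  rewrite act_imap_ext.
  change (act (rho A) x) with (cast (app_nil_r Γ0) (TR x IR)).
  rewrite ext_cast, act_cast, act_psi_ext, TR_cast_l, !cast_cast; now apply cast_irrel.
- change (act (phi' (A ⊗ C) Γ Δ) (cast (eq_sym (app_assoc Γ0 [C] (Γ ++ Δ)))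
      (ext (Γ ++ Δ) (TR x (pass (ax C))))) ≗
    cast (eq_sym (app_assoc Γ0 (C :: Γ) Δ)) (TR (cast (eq_sym (app_assoc Γ0 [C] Γ))
      (ext Γ (TR x (pass (ax C))))) (ext Δ IR))).
  rewrite act_cast, IH, TR_cast_l, !cast_cast; now apply cast_irrel.
Qed.

Definition base Var (S : stoup Var) : S ∣ [] ⊢ istoup S :=
  match S with Some A => ax A | None => IR end.

Definition univ Var (S : stoup Var) (Γ : ctx Var) : S ∣ Γ ⊢ iante S Γ := ext Γ (base S).

Lemma act_sound_univ Var (S : stoup Var) Γ C (f : S ∣ Γ ⊢ C) :
  act (sound f) (univ S Γ) ≗ f.
Proof.
induction f.
- cbn; now rewrite cast_id.
- change (act (sound f) (act (imap (lam A) Γ) (univ None (A :: Γ))) ≗ pass f).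
  (* Writing [f] as its own image and moving the action outside the left rule puts [act (sound f)]
     on both sides; only the derivations acted on remain to be compared. *)
  rewrite <- IHf at 2.
  rewrite <- (hom_pass (act_hom (sound f)) (univ (Some A) Γ)).
  apply act_proper.
  change (univ None (A :: Γ)) with
    (cast (eq_sym (app_assoc [] [A] Γ)) (ext Γ (TR IR (pass (ax A))))).
  rewrite act_cast, act_imap_ext, cast_id.
  (* [lam] acting on [TR IR (pass (ax A))] computes to [pass (ax A)], and [ext] commutes with
     [pass]. *)
  apply (hom_pass (ext_hom A Γ) (ax A)).
- change (act (sound f) (univ (Some I) Γ) ≗ IL f).
  rewrite <- IHf at 2.
  rewrite <- (hom_IL (act_hom (sound f)) (univ None Γ)).
  apply act_proper; unfold univ; cbn [base].
  rewrite ceq_ax_I; apply (hom_IL (ext_hom I Γ) IR).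
- cbn; now rewrite cast_id.
- change (act (sound f) (univ (Some (A ⊗ B)) Γ) ≗ TL f).
  rewrite <- IHf at 2.
  rewrite <- (hom_TL (act_hom (sound f)) (univ (Some A) (B :: Γ))).
  apply act_proper.
  change (univ (Some A) (B :: Γ)) with
    (cast (eq_sym (app_assoc [] [B] Γ)) (ext Γ (TR (ax A) (pass (ax B))))).
  rewrite cast_id; unfold univ; cbn [base].
  rewrite ceq_ax_T; apply (hom_TL (ext_hom (A ⊗ B) Γ) (TR (ax A) (pass (ax B)))).
- change (act (sound f1 ⊗c sound f2) (act (phi' (istoup S) Γ Δ) (ext (Γ ++ Δ) (base S)))
    ≗ TR f1 f2).
  rewrite act_phi'_ext, cast_id.
  change (TR (act (sound f1) (univ S Γ)) (act (sound f2) (univ None Δ)) ≗ TR f1 f2).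
  now rewrite IHf1, IHf2.
Qed.

(** * Interpretation of canonical derivations *)

Lemma ictx_app Var (A : fma Var) Γ Δ : ictx (ictx A Γ) Δ = ictx A (Γ ++ Δ).
Proof. revert A; induction Γ; cbn; auto. Qed.

Lemma sound_ext Var (S : stoup Var) Γ0 A Γ (x : S ∣ Γ0 ⊢ A)
    (e : ictx (iante S Γ0) Γ = iante S (Γ0 ++ Γ)) :
  sound (ext Γ x) ≐ dcast e (imap (sound x) Γ).
Proof.
revert A Γ0 x e; induction Γ as [|C Γ IH]; cbn; intros A Γ0 x e.
- rewrite sound_cast, (proof_irrelevance _ (f_equal _ _) e); reflexivity.
- assert (e1 : iante S (Γ0 ++ [C]) = iante S Γ0 ⊗ C)
    by (symmetry; apply (ictx_app (istoup S) Γ0 [C])).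
  assert (e2 : ictx (iante S (Γ0 ++ [C])) Γ = iante S ((Γ0 ++ [C]) ++ Γ))
    by apply ictx_app.
  rewrite sound_cast, (IH _ _ _ e2).
  (* One step of [ext] is interpreted as one step of [imap]: the [lam] coming from [pass] cancels by
     [phi'_single]. *)
  assert (E : dcast e1 (sound (TR x (pass (ax C)))) ≐ sound x ⊗c idc C).
  { cbn; rewrite dcast_comp, comp_idl.
    transitivity ((sound x ⊗c idc C) ∘ ((idc (iante S Γ0) ⊗c lam C) ∘
      dcast e1 (phi S Γ0 [C]))).
    - rewrite deq_assoc, tens_comp, comp_idr, comp_idl; reflexivity.
    - etransitivity; [apply deq_comp; [reflexivity|]; apply phi'_single|].
      apply comp_idr. }
  rewrite <- E, imap_dcast, !dcast_dcast.
  rewrite (proof_irrelevance _ (eq_trans e2 _) (eq_trans (f_equal (fun X => ictx X Γ) e1) e)); reflexivity.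
Qed.

Lemma sound_univ Var (S : stoup Var) Γ : sound (univ S Γ) ≐ idc (iante S Γ).
Proof.
etransitivity; [exact (sound_ext (base S) eq_refl)|]; cbn.
destruct S; apply imap_id.
Qed.

(** * Bijections between classes *)

(** A class goes to its image under [s], saturated by [Q]; the inverse is the preimage along [s].
    Both are given on predicates, so no representatives are chosen. *)
Lemma class_bijection X Y (R : X -> X -> Prop) (Q : Y -> Y -> Prop) (s : X -> Y) :
  Equivalence R -> Equivalence Q ->
  (forall x x', R x x' <-> Q (s x) (s x')) -> (forall y, exists x, Q y (s x)) ->
  exists F : eq_class R -> eq_class Q,
    Bijective F /\ forall x, F (class_of R x) = class_of Q (s x).
Proof.
intros HR HQ Hinj Hsurj.
assert (cong : forall Z (P P' : Z -> Prop), (forall z, P z <-> P' z) -> P = P')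
  by (intros Z P P' E; extensionality z; apply propositional_extensionality, E).
assert (EF : forall x, (fun y => exists x', R x x' /\ Q (s x') y) = Q (s x)).
{ intros x; apply cong; intros y; split.
  - intros (x' & Hx & Hy); apply Hinj in Hx; now rewrite Hx.
  - intros Hy; exists x; split; [reflexivity|exact Hy]. }
assert (EG : forall y x, Q y (s x) -> (fun x' => Q y (s x')) = R x).
{ intros y x Hy; apply cong; intros x'; rewrite Hinj, Hy; reflexivity. }
assert (F0 : forall P : eq_class R, exists y,
  (fun y => exists x', proj1_sig P x' /\ Q (s x') y) = Q y).
{ intros [P [x ->]]; exists (s x); apply EF. }
assert (G0 : forall P : eq_class Q, exists x, (fun x => proj1_sig P (s x)) = R x).
{ intros [P [y ->]]; destruct (Hsurj y) as [x Hx]; exists x; now apply EG. }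
exists (fun P => exist (fun P => exists y, P = Q y) _ (F0 P)); split.
- exists (fun P => exist (fun P => exists x, P = R x) _ (G0 P)); split.
  + intros [P [x ->]]; apply eq_sig_hprop; [intros; apply proof_irrelevance|]; cbn.
    apply cong; intros x'; split.
    * intros (x1 & H1 & H2); apply Hinj in H2; now rewrite H1.
    * intros H; exists x; split; [reflexivity|]; now apply Hinj.
  + intros [P [y ->]]; apply eq_sig_hprop; [intros; apply proof_irrelevance|]; cbn.
    apply cong; intros y'; split.
    * intros (x1 & H1 & H2); now rewrite H1.
    * intros H; destruct (Hsurj y) as [x Hx]; exists x; split; [exact Hx|].
      now rewrite <- Hx.
- intros x; apply eq_sig_hprop; [intros; apply proof_irrelevance|]; apply EF.
Qed.

Lemma sound_surjective Var (S : stoup Var) Γ C (h : iante S Γ ⇒ C) :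
  exists f : S ∣ Γ ⊢ C, h ≐ sound f.
Proof.
exists (act h (univ S Γ)).
rewrite sound_act, sound_univ, comp_idr; reflexivity.
Qed.

Lemma sound_injective Var (S : stoup Var) Γ C (f g : S ∣ Γ ⊢ C) :
  sound f ≐ sound g -> f ≗ g.
Proof.
intros H; rewrite <- (act_sound_univ f), <- (act_sound_univ g).
now apply act_doteq.
Qed.

Lemma sound_bijection Var (S : stoup Var) Γ C :
  exists F : cf_class S Γ C -> fsk_hom (iante S Γ) C,
    Bijective F /\ forall f : S ∣ Γ ⊢ C, F (cf_class_of f) = fsk_class_of (sound f).
Proof.
apply class_bijection.
- apply circeq_equivalence.
- apply doteq_equivalence.
- intros f g; split; [apply sound_circeq | apply sound_injective].
- apply sound_surjective.
Qed.

Theorem theorem4p13 (Var : Type) :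
  (forall (S : stoup Var) (Γ : ctx Var) (C : fma Var),
     (forall f g : S ∣ Γ ⊢ C, f ≗ g -> sound f ≐ sound g) /\
     (forall h : iante S Γ ⇒ C, exists f : S ∣ Γ ⊢ C, h ≐ sound f) /\
     (forall f g : S ∣ Γ ⊢ C, sound f ≐ sound g -> f ≗ g) /\
     (exists F : cf_class S Γ C -> fsk_hom (iante S Γ) C,
        Bijective F /\
        forall f : S ∣ Γ ⊢ C, F (cf_class_of f) = fsk_class_of (sound f))) /\
  (forall A C : fma Var,
     exists F : cf_class (Some A) [] C -> fsk_hom A C,
       Bijective F /\
       forall f : Some A ∣ [] ⊢ C, F (cf_class_of f) = fsk_class_of (sound f)).
Proof.
split.
- intros S Γ C; split; [|split; [|split]].
  + apply sound_circeq.
  + apply sound_surjective.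
  + apply sound_injective.
  + apply sound_bijection.
(* [iante (Some A) []] is convertible to [A]. *)
- intros A C; exact (sound_bijection (Some A) [] C).
Qed.
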